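(* Let $m(a,b)$ be a strict, isotone, symmetric mean in two variables, and let $M(a,b,c)$ be a mean in three variables that is invariant with respect to $m$. (A) $M$ is strict, isotone, and symmetric. (B) If $m$ is homogeneous, then $M$ is homogeneous. (C) Let $m_1,m_2$ be strict, isotone, symmetric means in two variables with $m_1(a,b)\le m(a,b)\le m_2(a,b)$ for all $(a,b)\in\mathbb{R}_+^2$, and let $M_1$ and $M_2$ be the means in three variables that are invariant with respect to $m_1$ and $m_2$ respectively. Then $M_1(a,b,c)\le M(a,b,c)\le M_2(a,b,c)$ for all $(a,b,c)\in\mathbb{R}_+^3$.
   Context: $\mathbb{R}_+^n=\{(a_1,\dots,a_n)\in\mathbb{R}^n: a_i>0\ \forall i\}$. A mean in $n$ variables is a continuous function $m$ on $\mathbb{R}_+^n$ with $\min(a_1,\dots,a_n)\le m(a_1,\dots,a_n)\le\max(a_1,\dots,a_n)$. It is symmetric if it is unchanged by every permutation of its arguments; strict if $m(a_1,\dots,a_n)$ equals $\min(a_1,\dots,a_n)$ or $\max(a_1,\dots,a_n)$ if and only if $a_1=\cdots=a_n$; homogeneous if $m(ka_1,\dots,ka_n)=k\,m(a_1,\dots,a_n)$ for all $k>0$; isotone if it is an increasing (i.e. non-decreasing) function of each of its variables. Here a mean $M(a,b,c)$ is called (type 1) invariant with respect to $m(a,b)$ if $M(m(a,c),m(a,b),m(b,c))=M(a,b,c)$ for all $(a,b,c)\in\mathbb{R}_+^3$. For a strict, isotone, symmetric mean $m$ there is exactly one mean in three variables that is invariant with respect to $m$. *)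

(* Defs.v *)
From HB Require Import structures.
From mathcomp Require Import all_boot all_order all_algebra all_fingroup.
From mathcomp Require Import all_classical all_reals all_analysis.
Import Order.TTheory GRing.Theory Num.Theory.
Import numFieldNormedType.Exports.

Set Implicit Arguments.
Unset Strict Implicit.
Unset Printing Implicit Defensive.

Local Open Scope classical_set_scope.
Local Open Scope ring_scope.

Section Means.
Variable R : realType.

Definition pos_orthant (n : nat) : set 'rV[R]_n :=
  [set a | forall i, 0 < a 0 i].

(* Since min and max of an empty family are meaningless, n.+1 is the number of
   variables below; seeding the fold with an entry of a does not change it. *)
Definition min_entry (n : nat) (a : 'rV[R]_n.+1) : R :=
  \big[Num.min/a 0 ord0]_(i < n.+1) a 0 i.

Definition max_entry (n : nat) (a : 'rV[R]_n.+1) : R :=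
  \big[Num.max/a 0 ord0]_(i < n.+1) a 0 i.

(* A function on the positive orthant is represented by a total function whose
   values elsewhere are irrelevant: every condition below only concerns
   arguments in the orthant, and continuity is that of the restriction. *)
Definition is_mean (n : nat) (m : 'rV[R]_n.+1 -> R) : Prop :=
  {within @pos_orthant n.+1, continuous m} /\
  (forall a, pos_orthant a -> min_entry a <= m a <= max_entry a).

Definition symmetric_mean (n : nat) (m : 'rV[R]_n.+1 -> R) : Prop :=
  forall (s : 'S_n.+1) a, pos_orthant a -> m (col_perm s a) = m a.

Definition strict_mean (n : nat) (m : 'rV[R]_n.+1 -> R) : Prop :=
  forall a, pos_orthant a ->
    (m a = min_entry a \/ m a = max_entry a) <->
    (forall i j, a 0 i = a 0 j).

Definition homogeneous_mean (n : nat) (m : 'rV[R]_n.+1 -> R) : Prop :=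
  forall (k : R) a, 0 < k -> pos_orthant a -> m (k *: a) = k * m a.

Definition isotone_mean (n : nat) (m : 'rV[R]_n.+1 -> R) : Prop :=
  forall (i : 'I_n.+1) a b, pos_orthant a -> pos_orthant b ->
    (forall j, j != i -> a 0 j = b 0 j) -> a 0 i <= b 0 i -> m a <= m b.

Definition vec2 (a b : R) : 'rV[R]_2 := \row_(i < 2) [:: a; b]`_i.

Definition vec3 (a b c : R) : 'rV[R]_3 := \row_(i < 3) [:: a; b; c]`_i.

Definition invariant_wrt (m : 'rV[R]_2 -> R) (M : 'rV[R]_3 -> R) : Prop :=
  forall a b c : R, 0 < a -> 0 < b -> 0 < c ->
    M (vec3 (m (vec2 a c)) (m (vec2 a b)) (m (vec2 b c))) = M (vec3 a b c).

End Means.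

(* Main.v *)
Require Import Defs.
From HB Require Import structures.
From mathcomp Require Import all_boot all_order all_algebra all_fingroup.
From mathcomp Require Import all_classical all_reals all_analysis.
Import Order.TTheory GRing.Theory Num.Theory.
Import numFieldNormedType.Exports.
Local Open Scope ring_scope.

(* Iterating (a,b,c) |-> (m(a,c), m(a,b), m(b,c)) makes the three entries converge
   to a common limit, and M, being constant along the orbit and between the least
   and the greatest entry, equals that limit.  Since the step is monotone in the
   triple and in m, commutes with scaling when m does, and sends rearrangements
   of a triple to rearrangements of its image, so does the limit; strictness holds
   because two steps move both extreme entries of a nonconstant triple inwards. *)

Section Means.
Context {R : realType}.
Implicit Types (a b c x y z : R) (p q s : R * R * R).

(** * Extreme entries, and vectors with two or three coordinates *)

Lemma min_entry_le {n} (a : 'rV[R]_n.+1) i : min_entry a <= a 0 i.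
Proof. exact: bigmin_le. Qed.

Lemma le_max_entry {n} (a : 'rV[R]_n.+1) i : a 0 i <= max_entry a.
Proof. exact: le_bigmax. Qed.

Lemma le_min_entry {n} (a : 'rV[R]_n.+1) x :
  (forall i, x <= a 0 i) -> x <= min_entry a.
Proof. by move=> xa; apply/bigmin_geP; split=> [|i _]; exact: xa. Qed.

Lemma max_entry_le {n} (a : 'rV[R]_n.+1) x :
  (forall i, a 0 i <= x) -> max_entry a <= x.
Proof. by move=> ax; apply/bigmax_leP; split=> [|i _]; exact: ax. Qed.

Lemma mean_bounds n (m : 'rV[R]_n.+1 -> R) (a : 'rV[R]_n.+1) lo hi :
  is_mean m -> 0 < lo -> (forall i, lo <= a 0 i <= hi) -> lo <= m a <= hi.
Proof.
move=> [_ mb] lo0 H.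
have /mb/andP[h1 h2] : pos_orthant a.
  by move=> i; apply: lt_le_trans lo0 _; case/andP: (H i).
apply/andP; split.
  by apply: le_trans h1; apply: le_min_entry => i; case/andP: (H i).
by apply: (le_trans h2); apply: max_entry_le => i; case/andP: (H i).
Qed.

Lemma forall_vec2 (P : R -> Prop) a b :
  P a -> P b -> forall i, P (vec2 a b 0 i).
Proof. by move=> Pa Pb [[|[|//]] i]; rewrite mxE. Qed.

Lemma forall_vec3 (P : R -> Prop) a b c :
  P a -> P b -> P c -> forall i, P (vec3 a b c 0 i).
Proof. by move=> Pa Pb Pc [[|[|[|//]]] i]; rewrite mxE. Qed.

Lemma vec3_entries (v : 'rV[R]_3) :
  v = vec3 (v 0 0) (v 0 1) (v 0 (inord 2)).
Proof.
apply/rowP => -[[|[|[|//]]] i]; rewrite mxE /=; congr (v 0 _).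
  1,2: exact: val_inj.
apply: val_inj => /=.
by rewrite inordK.
Qed.

(** Iteration takes place on [R * R * R], whose projections compute; this carries [M] over to such
    triples. *)
Definition at_triple (M : 'rV[R]_3 -> R) p := M (vec3 p.1.1 p.1.2 p.2).

Lemma at_tripleE (M : 'rV[R]_3 -> R) v :
  M v = at_triple M (v 0 0, v 0 1, v 0 (inord 2)).
Proof. by rewrite /at_triple -vec3_entries. Qed.

Lemma cvg_vec2 (u v : nat -> R) x y :
  (u n @[n --> \oo] --> x)%classic -> (v n @[n --> \oo] --> y)%classic ->
  (vec2 (u n) (v n) @[n --> \oo] --> vec2 x y)%classic.
Proof.
move=> /cvg_ballP ux /cvg_ballP vy; apply/cvg_ballP => e e0.
near=> n; split=> // i j; rewrite ord1 !mxE.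
case: j => [[|[|//]]] j /=; near: n; [exact: ux|exact: vy].
Unshelve. all: by end_near. Qed.

(** * Means in two variables *)

Section BinaryMean.
Context {m : 'rV[R]_2 -> R}.
Hypotheses (m_mean : is_mean m) (m_strict : strict_mean m).
Hypotheses (m_isotone : isotone_mean m) (m_symmetric : symmetric_mean m).

Lemma mean2_bounds lo hi a b :
  0 < lo -> lo <= a <= hi -> lo <= b <= hi -> lo <= m (vec2 a b) <= hi.
Proof.
move=> lo0 ha hb; apply: mean_bounds => //.
by apply: (@forall_vec2 (fun t => lo <= t <= hi)).
Qed.

Lemma mean2_gt0 a b : 0 < a -> 0 < b -> 0 < m (vec2 a b).
Proof.
move=> a0 b0.
have : Num.min a b <= m (vec2 a b) <= Num.max a b.
  by apply: mean2_bounds; rewrite ?lt_min ?a0 // ?ge_min ?le_max !lexx ?orbT.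
by case/andP=> h _; apply: lt_le_trans h; rewrite lt_min a0.
Qed.

Lemma mean2C a b : 0 < a -> 0 < b -> m (vec2 a b) = m (vec2 b a).
Proof.
move=> a0 b0; rewrite -(m_symmetric (tperm 0 1) (vec2 b a)); last first.
  by apply: (@forall_vec2 (fun t => 0 < t)).
congr (m _); apply/rowP => -[[|[|//]] i]; rewrite !mxE.
  by rewrite (_ : Ordinal i = 0) ?tpermL //; exact: val_inj.
by rewrite (_ : Ordinal i = 1) ?tpermR //; exact: val_inj.
Qed.

Lemma mean2_mono a b a' b' : 0 < a -> 0 < b -> a <= a' -> b <= b' ->
  m (vec2 a b) <= m (vec2 a' b').
Proof.
move=> a0 b0 aa' bb'.
have a'0 := lt_le_trans a0 aa'; have b'0 := lt_le_trans b0 bb'.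
have pos c d : 0 < c -> 0 < d -> pos_orthant (vec2 c d).
  by move=> *; apply: (@forall_vec2 (fun t => 0 < t)).
apply: (@le_trans _ _ (m (vec2 a' b))).
  by apply: (m_isotone 0) => //; [exact: pos|exact: pos|case=> -[|[|//]] j //|];
    rewrite !mxE.
by apply: (m_isotone 1) => //; [exact: pos|exact: pos|case=> -[|[|//]] j //|];
    rewrite !mxE.
Qed.

Lemma mean2_strict a b : 0 < a -> a < b -> a < m (vec2 a b) < b.
Proof.
move=> a0 ab; have b0 := lt_trans a0 ab.
have pos : pos_orthant (vec2 a b) by apply: (@forall_vec2 (fun t => 0 < t)).
have mineq : min_entry (vec2 a b) = a.
  apply/le_anti/andP; split.
    by apply: (le_trans (min_entry_le _ 0)); rewrite mxE.
  by apply/le_min_entry/(@forall_vec2 (fun t => a <= t)) => //; exact: ltW.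
have maxeq : max_entry (vec2 a b) = b.
  apply/le_anti/andP; split; last first.
    by apply: le_trans (le_max_entry _ 1); rewrite mxE.
  by apply/max_entry_le/(@forall_vec2 (fun t => t <= b)) => //; exact: ltW.
have := m_strict _ pos; rewrite mineq maxeq => -[eqab _].
have neq : ~ (m (vec2 a b) = a \/ m (vec2 a b) = b).
  by move/eqab => /(_ 0 1); rewrite !mxE /= => e; move: ab; rewrite e ltxx.
have /andP[h1 h2] : a <= m (vec2 a b) <= b.
  by apply: mean2_bounds; rewrite ?lexx ?(ltW ab).
rewrite !lt_neqAle h1 h2 !andbT; apply/andP; split; apply/eqP => e; apply: neq;
  by [left|right].
Qed.

Lemma mean2_cvg (u v : nat -> R) x y :
  (forall n, 0 < u n) -> (forall n, 0 < v n) -> 0 < x -> 0 < y ->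
  (u n @[n --> \oo] --> x)%classic -> (v n @[n --> \oo] --> y)%classic ->
  (m (vec2 (u n) (v n)) @[n --> \oo] --> m (vec2 x y))%classic.
Proof.
move=> u0 v0 x0 y0 ux vy; case: m_mean => /subspace_continuousP cm _.
have pos c d : 0 < c -> 0 < d -> pos_orthant (vec2 c d).
  by move=> *; apply: (@forall_vec2 (fun t => 0 < t)).
apply: cvg_trans (cm _ (pos _ _ x0 y0)).
(* Continuity within the orthant constrains only points of the orthant, and every [vec2 (u n) (v n)]
   is one. *)
move=> A /= hA; have := cvg_vec2 _ _ _ _ ux vy _ hA.
rewrite /nbhs /=; apply: filterS => n /=; apply; exact: pos.
Qed.

(* The map whose orbits carry the invariant mean; [sorted_step] is its effect on
   increasing triples, up to the order of the entries. *)
Definition step p :=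
  (m (vec2 p.1.1 p.2), m (vec2 p.1.1 p.1.2), m (vec2 p.1.2 p.2)).

Definition sorted_step p :=
  (m (vec2 p.1.1 p.1.2), m (vec2 p.1.1 p.2), m (vec2 p.1.2 p.2)).

(** * Orbits of increasing triples *)

Definition pos_sorted p := 0 < p.1.1 /\ p.1.1 <= p.1.2 <= p.2.

Lemma sorted_step_bounds p : pos_sorted p ->
  p.1.1 <= (sorted_step p).1.1 /\ (sorted_step p).2 <= p.2.
Proof.
case: p => [[x y] z] [/= x0 /andP[xy yz]]; split.
  have /andP[] : x <= m (vec2 x y) <= y.
    by apply: mean2_bounds; rewrite ?lexx ?xy.
  by [].
have /andP[] : y <= m (vec2 y z) <= z; last by [].
by apply: mean2_bounds; rewrite ?lexx ?yz ?(lt_le_trans x0).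
Qed.

(** Isotony gives m(x, y) <= m(x, z) <= m(y, z), which is why [sorted_step] lists the three means in
    this order. *)
Lemma sorted_step_sorted p : pos_sorted p -> pos_sorted (sorted_step p).
Proof.
case: p => [[x y] z] [/= x0 /andP[xy yz]].
have y0 := lt_le_trans x0 xy; have z0 := lt_le_trans y0 yz.
by split; [exact: mean2_gt0|apply/andP; split; apply: mean2_mono].
Qed.

Lemma sorted_orbit_sorted p n :
  pos_sorted p -> pos_sorted (iter n sorted_step p).
Proof. by move=> ps; elim: n => //= n; exact: sorted_step_sorted. Qed.

(* If [l < h] are the limits of the smallest and largest entries, the middle one
   tends to [m(l, h) > l], so the smallest one tends to [m(l, m(l, h)) > l]. *)
Lemma sorted_orbit_cvg p : pos_sorted p -> exists l : R,
  ((iter n sorted_step p).1.1 @[n --> \oo] --> l)%classic /\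
  ((iter n sorted_step p).2 @[n --> \oo] --> l)%classic.
Proof.
move=> ps; pose u n := (iter n sorted_step p).1.1.
pose v n := (iter n sorted_step p).1.2; pose w n := (iter n sorted_step p).2.
have uvw n : pos_sorted (u n, v n, w n).
  by have := sorted_orbit_sorted p n ps; rewrite /u /v /w;
    case: (iter n sorted_step p) => [[]].
have u0 n : 0 < u n by case: (uvw n).
have v0 n : 0 < v n by case: (uvw n) => /= ? /andP[h _]; exact: lt_le_trans h.
have uw n : u n <= w n.
  by case: (uvw n) => /= ? /andP[]; exact: le_trans.
have w0 n : 0 < w n by exact: lt_le_trans (uw n).
have uhomo : {homo u : n k / (n <= k)%N >-> n <= k}.
  apply/nondecreasing_seqP => n.
  by have [] := sorted_step_bounds _ (sorted_orbit_sorted p n ps).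
have whomo : {homo w : n k / (n <= k)%N >-> k <= n}.
  apply/nonincreasing_seqP => n.
  by have [] := sorted_step_bounds _ (sorted_orbit_sorted p n ps).
have ucvg : cvgn u.
  apply: nondecreasing_is_cvgn => //; exists (w 0) => _ [n _ <-].
  by apply: (le_trans (uw n)); exact: whomo.
have wcvg : cvgn w.
  apply: nonincreasing_is_cvgn => //; exists (u 0) => _ [n _ <-].
  by apply: le_trans (uw n); exact: uhomo.
pose l := limn u; pose h := limn w.
have l0 : 0 < l by apply: lt_le_trans (nondecreasing_cvgn_le uhomo ucvg 0).
have lh : l <= h by apply: ler_cvg_to ucvg wcvg _; exact: nearW.
have h0 : 0 < h := lt_le_trans l0 lh.
(* Dropping the first term exposes the recurrences [v n.+1] = m([u n], [w n]) and, next, [u n.+1] =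
   m([u n], [v n]), to which continuity applies. *)
have vcvg : (v n @[n --> \oo] --> m (vec2 l h))%classic.
  by rewrite -cvg_shiftS; apply: mean2_cvg.
have ucvg' : (u n @[n --> \oo] --> m (vec2 l (m (vec2 l h))))%classic.
  by rewrite -cvg_shiftS; apply: mean2_cvg => //; apply: mean2_gt0.
have lE : l = m (vec2 l (m (vec2 l h))).
  by exact: (cvg_unique (@Rhausdorff R) ucvg ucvg').
exists l; split; first exact: ucvg.
suff -> : l = h by exact: wcvg.
apply/eqP; move: lh; rewrite le_eqVlt => /orP[//|lh].
have /andP[h1 _] := mean2_strict _ _ l0 lh.
by have /andP[] := mean2_strict _ _ l0 h1; rewrite -lE ltxx.
Qed.

(** * Reduction of arbitrary triples to increasing ones *)

Definition rearranges p s := let: (x, y, z) := s in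
  p = (x, y, z) \/ p = (x, z, y) \/ p = (y, x, z) \/ p = (y, z, x) \/
  p = (z, x, y) \/ p = (z, y, x).

Lemma exists_sorted a b c : 0 < a -> 0 < b -> 0 < c ->
  exists2 s, pos_sorted s & rearranges (a, b, c) s.
Proof.
move=> a0 b0 c0.
have [ab|/ltW ba] := leP a b; have [bc|/ltW cb] := leP b c;
  have [ac|/ltW ca] := leP a c.
(* The second and seventh cases are cyclic and cannot occur; they need no refutation, as their first
   two comparisons already give an increasing order. *)
- by exists (a, b, c); [split => //=; apply/andP|rewrite /=; tauto].
- by exists (a, b, c); [split => //=; apply/andP|rewrite /=; tauto].
- by exists (a, c, b); [split => //=; apply/andP|rewrite /=; tauto].
- by exists (c, a, b); [split => //=; apply/andP|rewrite /=; tauto].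
- by exists (b, a, c); [split => //=; apply/andP|rewrite /=; tauto].
- by exists (b, c, a); [split => //=; apply/andP|rewrite /=; tauto].
- by exists (c, b, a); [split => //=; apply/andP|rewrite /=; tauto].
- by exists (c, b, a); [split => //=; apply/andP|rewrite /=; tauto].
Qed.

Lemma rearranges_bounds p s : pos_sorted s -> rearranges p s ->
  [/\ s.1.1 <= p.1.1 <= s.2, s.1.1 <= p.1.2 <= s.2 & s.1.1 <= p.2 <= s.2].
Proof.
case: s => [[x y] z] [/= _ /andP[xy yz]]; have xz := le_trans xy yz.
by move=> [|[|[|[|[|]]]]] ->; rewrite /= ?lexx ?xy ?yz ?xz.
Qed.

(** The entries of [step p] are the means of the three pairs of entries of [p]. Reordering [p]
    permutes these pairs and may flip some of them, and flips are undone by the symmetry of [m]. *)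
Lemma step_rearranges p s : pos_sorted s -> rearranges p s ->
  rearranges (step p) (sorted_step s).
Proof.
case: s => [[x y] z] [/= x0 /andP[xy yz]].
have y0 := lt_le_trans x0 xy; have z0 := lt_le_trans y0 yz.
by move=> [|[|[|[|[|]]]]] ->; rewrite /step /= ?(mean2C y x) ?(mean2C z x)
  ?(mean2C z y) //; tauto.
Qed.

Lemma orbit_rearranges p s n : pos_sorted s -> rearranges p s ->
  rearranges (iter n step p) (iter n sorted_step s).
Proof.
move=> ss ps; elim: n => //= n; apply: step_rearranges.
exact: sorted_orbit_sorted.
Qed.

Definition pos3 p := [/\ 0 < p.1.1, 0 < p.1.2 & 0 < p.2].

Lemma step_pos3 p : pos3 p -> pos3 (step p).
Proof. by move=> [? ? ?]; split; apply: mean2_gt0. Qed.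

Lemma orbit_pos3 p n : pos3 p -> pos3 (iter n step p).
Proof. by move=> p0; elim: n => //= n; exact: step_pos3. Qed.

(** * The invariant mean as a limit, and its properties *)

Section InvariantMean.
Context {M : 'rV[R]_3 -> R}.
Hypotheses (M_mean : is_mean M) (M_invariant : invariant_wrt m M).

Local Notation M3 := (at_triple M).

Lemma invariant_orbit p n : pos3 p -> M3 (iter n step p) = M3 p.
Proof.
move=> p0; elim: n => //= n <-.
by have [] := orbit_pos3 p n p0; exact: M_invariant.
Qed.

Lemma mean3_bounds lo hi a b c : 0 < lo -> lo <= a <= hi -> lo <= b <= hi ->
  lo <= c <= hi -> lo <= M (vec3 a b c) <= hi.
Proof.
move=> lo0 ha hb hc; apply: mean_bounds => //.
by apply: (@forall_vec3 (fun t => lo <= t <= hi)).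
Qed.

Lemma rearranges_pos3 p s : pos_sorted s -> rearranges p s -> pos3 p.
Proof.
move=> ss ps; have [s0 _] := ss.
by have [/andP[? _] /andP[? _] /andP[? _]] := rearranges_bounds _ _ ss ps;
  split; exact: lt_le_trans s0 _.
Qed.

(** Stated for every [n]: letting [n] grow determines [M], while [n = 2] gives strictness. *)
Lemma invariant_bounds p s n : pos_sorted s -> rearranges p s ->
  (iter n sorted_step s).1.1 <= M3 p <= (iter n sorted_step s).2.
Proof.
move=> ss ps; rewrite -(invariant_orbit _ n (rearranges_pos3 _ _ ss ps)).
have ssn := sorted_orbit_sorted s n ss.
have [h1 h2 h3] := rearranges_bounds _ _ ssn (orbit_rearranges _ _ n ss ps).
by apply: mean3_bounds => //; case: ssn.
Qed.

Lemma rearranges_limit p s : pos_sorted s -> rearranges p s ->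
  ((iter n sorted_step s).1.1 @[n --> \oo] --> M3 p)%classic /\
  ((iter n sorted_step s).2 @[n --> \oo] --> M3 p)%classic.
Proof.
move=> ss ps; have [l [ul wl]] := sorted_orbit_cvg s ss.
suff -> : M3 p = l by [].
(* The constant sequence [M3 p] is squeezed between the extreme entries of the sorted orbit. *)
have cl : (M3 p @[n --> \oo] --> l)%classic.
  by apply: squeeze_cvgr ul wl; apply: nearW => n; exact: invariant_bounds.
by apply: (cvg_unique (@Rhausdorff R) _ cl); exact: cvg_cst.
Qed.

(** With no sorting in the conclusion, two orbits can be compared or scaled entry by entry, without
    matching their rearrangements. *)
Lemma orbit_cvg p : pos3 p ->
  ((iter n step p).1.1 @[n --> \oo] --> M3 p)%classic.
Proof.
case: p => [[a b] c] [/= a0 b0 c0].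
have [s ss ps] := exists_sorted _ _ _ a0 b0 c0.
have [ul wl] := rearranges_limit _ _ ss ps.
apply: squeeze_cvgr ul wl; apply: nearW => n.
by have [] := rearranges_bounds _ _ (sorted_orbit_sorted s n ss)
  (orbit_rearranges _ _ n ss ps).
Qed.

(** Both values are the limit of the same sorted orbit, that of [s]; symmetry of [M] follows. *)
Lemma rearranges_invariant p q s : pos_sorted s -> rearranges p s ->
  rearranges q s -> M3 p = M3 q.
Proof.
move=> ss ps qs; have [hp _] := rearranges_limit _ _ ss ps.
have [hq _] := rearranges_limit _ _ ss qs.
exact: (cvg_unique (@Rhausdorff R) hp hq).
Qed.

(* Two steps are needed: when two of the three entries agree, one step can leave
   an extreme entry in place. *)
Lemma invariant_strict p s : pos_sorted s -> rearranges p s -> s.1.1 < s.2 ->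
  s.1.1 < M3 p < s.2.
Proof.
move=> ss ps xz; have /andP[h1 h2] := invariant_bounds p s 2 ss ps.
suff [l1 l2] : s.1.1 < (iter 2 sorted_step s).1.1 /\
    (iter 2 sorted_step s).2 < s.2.
  by apply/andP; split; [exact: lt_le_trans l1 h1|exact: le_lt_trans h2 l2].
have [s1 s2] := sorted_step_bounds _ ss.
have [s3 s4] := sorted_step_bounds _ (sorted_step_sorted _ ss).
have /andP[xm mz] := mean2_strict _ _ ss.1 xz.
have m0 := lt_trans ss.1 xm; split.
  (* With [s] = (x, y, z): if the first step leaves x in place, the second puts m(x, m(x, z)) there,
     and this exceeds x because m(x, z) does. Dually, z is replaced by m(m(x, z), z) < z. *)
  move: s1; rewrite le_eqVlt => /orP[/eqP e|lt]; last exact: lt_le_trans s3.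
  move: e => /= e; rewrite /= -e.
  by have /andP[] := mean2_strict _ _ ss.1 xm.
move: s2; rewrite le_eqVlt => /orP[/eqP e|lt]; last exact: le_lt_trans lt.
move: e => /= e; rewrite /= e.
by have /andP[] := mean2_strict _ _ m0 mz.
Qed.

Lemma pos_orthant_pos3 (v : 'rV[R]_3) :
  pos_orthant v -> pos3 (v 0 0, v 0 1, v 0 (inord 2)).
Proof. by move=> v0; split; exact: v0. Qed.

Lemma invariant_strict_mean : strict_mean M.
Proof.
move=> v v0; split; last first.
  move=> eqv; left; have c0 := v0 0.
  have /andP[h1 h2] : v 0 0 <= M v <= v 0 0.
    by apply: mean_bounds => // i; rewrite (eqv i 0) lexx.
  apply/le_anti/andP; split; last by apply: le_trans h1; exact: min_entry_le.
  by apply: (le_trans h2); apply: le_min_entry => i; rewrite (eqv 0 i).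
have [a0 b0 c0] := pos_orthant_pos3 _ v0.
have [s ss ps] := exists_sorted _ _ _ a0 b0 c0.
have [h1 h2 h3] := rearranges_bounds _ _ ss ps.
have vb i : s.1.1 <= v 0 i <= s.2.
  rewrite (vec3_entries v).
  by apply: (@forall_vec3 (fun t => s.1.1 <= t <= s.2)).
(* Both ends of [s] occur among the entries of [v]. *)
have minE : min_entry v <= s.1.1.
  by case: (s) ps => [[x y] z] /= [|[|[|[|[|]]]]] [? ? ?]; subst;
    exact: min_entry_le.
have maxE : s.2 <= max_entry v.
  by case: (s) ps => [[x y] z] /= [|[|[|[|[|]]]]] [? ? ?]; subst;
    exact: le_max_entry.
have : s.1.1 <= s.2 by have /andP[] := h1; exact: le_trans.
rewrite le_eqVlt => /orP[/eqP e _ i j|xz].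
  have vE k : v 0 k = s.1.1 by apply/le_anti; rewrite {1}e andbC.
  by rewrite !vE.
have /andP[l1 l2] := invariant_strict _ _ ss ps xz.
by rewrite at_tripleE => -[] e; move: l1 l2; rewrite e ltNge ?minE // => _;
  rewrite ltNge maxE.
Qed.

Lemma invariant_symmetric_mean : symmetric_mean M.
Proof.
move=> s v v0; have [a0 b0 c0] := pos_orthant_pos3 _ v0.
have [t ts vt] := exists_sorted _ _ _ a0 b0 c0.
rewrite (at_tripleE _ v) at_tripleE.
apply: (rearranges_invariant _ _ _ ts _ vt).
pose o2 : 'I_3 := inord 2; rewrite -/o2 !mxE.
have ord3 (i : 'I_3) : i = 0 \/ i = 1 \/ i = o2.
  case: i => [[|[|[|//]]] i];
    [left|right; left|right; right]; apply: val_inj => //=.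
  by rewrite inordK.
have o02 : 0 <> o2 by move=> /(congr1 val); rewrite /= inordK.
have o12 : 1 <> o2 by move=> /(congr1 val); rewrite /= inordK.
have s01 : s 0 <> s 1 by move/perm_inj.
have s02 : s 0 <> s o2 by move/perm_inj.
have s12 : s 1 <> s o2 by move/perm_inj.
case: t ts vt => [[x y] z] _ /= vt.
(* Injectivity leaves six possible values of ([s 0], [s 1], [s o2]), each checked against the six
   arrangements of [v]. *)
case: (ord3 (s 0)) s01 s02 => [|[|]] -> s01 s02;
  case: (ord3 (s 1)) s01 s12 => [|[|]] -> s01 s12 //;
  case: (ord3 (s o2)) s02 s12 => [|[|]] -> s02 s12 //;
  by case: vt => [|[|[|[|[|]]]]] [-> -> ->]; tauto.
Qed.

Lemma invariant_homogeneous_mean : homogeneous_mean m -> homogeneous_mean M.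
Proof.
move=> m_hom k v k0 v0; have p0 := pos_orthant_pos3 _ v0.
set p := (_, _, _) in p0.
pose scale q : R * R * R := (k * q.1.1, k * q.1.2, k * q.2).
have scale_pos q : pos3 q -> pos3 (scale q).
  by move=> [? ? ?]; split; exact: mulr_gt0.
have m_scale a b : 0 < a -> 0 < b ->
    m (vec2 (k * a) (k * b)) = k * m (vec2 a b).
  move=> a0 b0; rewrite -m_hom //; last first.
    by apply: (@forall_vec2 (fun t => 0 < t)).
  by congr m; apply/rowP => -[[|[|//]] i]; rewrite !mxE.
(* Homogeneity of [m] holds on the orthant only, so the induction uses that the orbit stays
   positive. *)
have orbit_scale n : iter n step (scale p) = scale (iter n step p).
  elim: n => //= n ->; have [? ? ?] := orbit_pos3 _ n p0.
  by rewrite /step /scale /= !m_scale.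
have MkvE : M (k *: v) = M3 (scale p) by rewrite at_tripleE !mxE.
have hk := orbit_cvg _ (scale_pos _ p0).
have h1 : (k * (iter n step p).1.1 @[n --> \oo] --> k * M3 p)%classic.
  by apply: cvgMl_tmp; exact: orbit_cvg.
rewrite MkvE (at_tripleE _ v) -/p; apply: (cvg_unique (@Rhausdorff R) hk).
rewrite (_ : (fun n => _) = fun n => k * (iter n step p).1.1) //.
by apply/funext => n; rewrite orbit_scale.
Qed.

End InvariantMean.
End BinaryMean.

(** The mean and the triple vary together: [m' = m] gives isotony of [M], and equal triples give the
    comparison of invariant means. *)
Lemma invariant_mono (m m' : 'rV[R]_2 -> R) (M M' : 'rV[R]_3 -> R)
    a b c a' b' c' :
  is_mean m -> strict_mean m -> isotone_mean m -> symmetric_mean m ->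
  is_mean m' -> strict_mean m' -> isotone_mean m' -> symmetric_mean m' ->
  (forall x y, 0 < x -> 0 < y -> m (vec2 x y) <= m' (vec2 x y)) ->
  is_mean M -> invariant_wrt m M -> is_mean M' -> invariant_wrt m' M' ->
  0 < a -> 0 < b -> 0 < c -> a <= a' -> b <= b' -> c <= c' ->
  M (vec3 a b c) <= M' (vec3 a' b' c').
Proof.
move=> mm ms mi mc m'm m's m'i m'c mm' Mm Mi M'm M'i a0 b0 c0 aa' bb' cc'.
have p0 : pos3 (a, b, c) by [].
have p'0 : pos3 (a', b', c')
  by split;
    [exact: lt_le_trans aa'|exact: lt_le_trans bb'|exact: lt_le_trans cc'].
have hp := orbit_cvg mm ms mi mc Mm Mi _ p0.
have hp' := orbit_cvg m'm m's m'i m'c M'm M'i _ p'0.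
apply: ler_cvg_to hp hp' _; apply: nearW => n.
(* Isotony of [m] moves the arguments first, then [mm'] changes the mean. *)
have m_le x y x' y' : 0 < x -> 0 < y -> x <= x' -> y <= y' ->
    m (vec2 x y) <= m' (vec2 x' y').
  move=> x0 y0 xx' yy'; apply: le_trans (mm' _ _ _ _); first exact: mean2_mono.
    exact: lt_le_trans xx'.
  exact: lt_le_trans yy'.
(* The limits concern first entries only, but each entry of a step mixes two earlier ones, so the
   induction carries all three. *)
suff [] : let p := iter n (@step m) (a, b, c) in
    let q := iter n (@step m') (a', b', c') in
    [/\ p.1.1 <= q.1.1, p.1.2 <= q.1.2 & p.2 <= q.2] by [].
elim: n => [//|n [h1 h2 h3]] /=.
have [? ? ?] := orbit_pos3 mm _ n p0.
by split; exact: m_le.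
Qed.

End Means.

Theorem proposition5 (R : realType) (m : 'rV[R]_2 -> R) (M : 'rV[R]_3 -> R)
  (m_mean : is_mean m) (m_strict : strict_mean m) (m_isotone : isotone_mean m)
  (m_symmetric : symmetric_mean m)
  (M_mean : is_mean M) (M_invariant : invariant_wrt m M) :
  [/\ strict_mean M, isotone_mean M & symmetric_mean M] /\
  (homogeneous_mean m -> homogeneous_mean M) /\
  (forall (m1 m2 : 'rV[R]_2 -> R) (M1 M2 : 'rV[R]_3 -> R),
     is_mean m1 -> strict_mean m1 -> isotone_mean m1 -> symmetric_mean m1 ->
     is_mean m2 -> strict_mean m2 -> isotone_mean m2 -> symmetric_mean m2 ->
     (forall a b : R, 0 < a -> 0 < b ->
        m1 (vec2 a b) <= m (vec2 a b) <= m2 (vec2 a b)) ->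
     is_mean M1 -> invariant_wrt m1 M1 ->
     is_mean M2 -> invariant_wrt m2 M2 ->
     forall a b c : R, 0 < a -> 0 < b -> 0 < c ->
       M1 (vec3 a b c) <= M (vec3 a b c) <= M2 (vec3 a b c)).
Proof.
split; last split; first split.
- exact: (@invariant_strict_mean _ m).
- move=> i a b a0 b0 eq_ab le_ab.
  (* Changing one variable is a special case of an entrywise comparison. *)
  have ab j : a 0 j <= b 0 j by case: (eqVneq j i) => [->|/eq_ab ->].
  by rewrite (vec3_entries a) (vec3_entries b); exact: (invariant_mono m m).
- exact: (@invariant_symmetric_mean _ m).
- exact: (@invariant_homogeneous_mean _ m).
move=> m1 m2 M1 M2 m1m m1s m1i m1c m2m m2s m2i m2c mm M1m M1i M2m M2i a b c.
move=> a0 b0 c0; apply/andP; split.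
  by apply: (invariant_mono m1 m) => // x y x0 y0; case/andP: (mm x y x0 y0).
by apply: (invariant_mono m m2) => // x y x0 y0; case/andP: (mm x y x0 y0).
Qed.
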